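(* Let $U,b$ be strictly positive rationals, $T\ge1$ an integer, $\mu,x_0\in[0,U]_{\mathcal Q}$, and suppose $x_0\in[0,\chi^T_{\mathbf{MAR}}(\mu,U,b)]$. Then one can construct, on a common probability space, a random vector $\hat{\mathbf D}^*=(\hat D^*_1,\dots,\hat D^*_T)$ distributed as $\hat Q^*$, the Markov chain $M^T$, and independent random variables $Z^T,Y^T$ with respective laws $\mathcal Z^T,\mathcal Y^T$, such that with probability 1 $\{(\hat x^*_t(\hat D^*_{[t-1]}),\hat D^*_t),\,t\in[1,T]\}$ equals $\{(\mathcal X^T_t,\mathcal D^T_t),\,t\in[1,T]\}$ and all of the following hold: (a) $(\mathcal X^T_t,\mathcal D^T_t)=(X^T_t,D^T_t)$ for all $t\in[1,Z^T-1]$. (b) If $Z^T\le\Lambda^T-1$, then $(\mathcal X^T_t,\mathcal D^T_t)=(X^T_{Z^T},0)$ for all $t\in[Z^T,T]$. (c) If $Z^T=\Lambda^T$ and $Y^T=U$, then $(\mathcal X^T_{\Lambda^T},\mathcal D^T_{\Lambda^T})=(X^T_{\Lambda^T},U)$ and $(\mathcal X^T_t,\mathcal D^T_t)=(U,U)$ for all $t\in[\Lambda^T+1,T]$. (d) If $Z^T=\Lambda^T$ and $Y^T=0$, then $(\mathcal X^T_t,\mathcal D^T_t)=(X^T_{\Lambda^T},0)$ for all $t\in[\Lambda^T,T]$. (e) $\hat D^*_t=D^T_t\,I(Z^T>t)$ for $t\in[1,\Lambda^T-1]$, and $\hat D^*_t=U\,I(Z^T=\Lambda^T,\,Y^T=U)$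 for $t\in[\Lambda^T,T]$.
   Context: $[0,U]_{\mathcal Q}=[0,U]\cap\mathbb Q$; intervals of time/index variables are integer intervals; for a vector $\mathbf d$, $\mathbf d_{[s]}=(d_1,\dots,d_s)$; $I(\cdot)$ is the indicator. Empty products equal 1. Explicit quantities, for each integer $T\ge1$: for $j\in[-1,T-1]$, $A^T_j=U\prod_{k=j+1}^{T-1}\frac{k}{b+k}$, and $A^T_T=\frac{b+T}{T}U$; for $j\in[-1,T]$, $B^T_j=\frac{j}{b+T}A^T_j$. $\Gamma^T_\mu=0$ if $\mu=0$, and $\Gamma^T_\mu=j+1$ if $\mu\in(A^{T+1}_j,A^{T+1}_{j+1}]$, $j\in[-1,T-1]$. $\chi^T_{\mathbf{MAR}}(\mu,U,b)=B^T_{\Gamma^T_\mu}$. For $x,\mu\in[0,U]$, $\mathfrak q^T_{x,\mu}$ is the probability measure given by: (i) if $\mu\in(A^T_j,A^T_{j+1}]$ and $x\in[0,B^T_{j+1})$: $\mathfrak q^T_{x,\mu}(A^T_j)=\frac{A^T_{j+1}-\mu}{A^T_{j+1}-A^T_j}$, $\mathfrak q^T_{x,\mu}(A^T_{j+1})=\frac{\mu-A^T_j}{A^T_{j+1}-A^T_j}$; (ii) if $\mu\in(A^T_j,A^T_{j+1}]$ and $x\in[B^T_k,B^T_{k+1})$ with $k\ge j+1$: $\mathfrak q^T_{x,\mu}(0)=1-\frac{\mu}{A^T_k}$, $\mathfrak q^T_{x,\mu}(A^T_k)=\frac{\mu}{A^T_k}$; (iii) if $\mu=0$ or $x=U$: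 $\mathfrak q^T_{x,\mu}(0)=1-\frac{\mu}{U}$, $\mathfrak q^T_{x,\mu}(U)=\frac{\mu}{U}$. Policy $\hat\pi^*=(\hat x^*_1,\dots,\hat x^*_T)$: $\hat x^*_1=\max(x_0,\chi^T_{\mathbf{MAR}}(\mu,U,b))$ and, for $t\in[1,T-1]$, $\hat x^*_{t+1}(\mathbf d_{[t]})=\max(\hat x^*_t(\mathbf d_{[t-1]})-d_t,\chi^{T-t}_{\mathbf{MAR}}(d_t,U,b))$. Measure $\hat Q^*$ on $[0,U]_{\mathcal Q}^T$: the first coordinate has law $\mathfrak q^T_{\hat x^*_1,\mu}$, and given that the first $t$ coordinates equal $\mathbf d=(d_1,\dots,d_t)$ (of positive probability), coordinate $t+1$ has conditional law $\mathfrak q^{T-t}_{\hat x^*_{t+1}(\mathbf d),d_t}$. Markov chain. $\Lambda^T=\max(T-\Gamma^T_\mu,1)$; $D^T_0=\mu$; for $t\in[1,\Lambda^T]$: $D^T_t=A^{T+1-t}_{\min(\Gamma^T_\mu,T-1)}$, $X^T_t=B^{T+1-t}_{\Gamma^T_\mu}$. $M^T(t)=(\mathcal X^T_t,\mathcal D^T_t)$, $t\ge1$, is the Markov chain with: $(\mathcal X^T_1,\mathcal D^T_1)=(X^T_1,D^T_1)$ with probability $\mu/D^T_1$ and $(X^T_1,0)$ with probability $1-\mu/D^T_1$; for $t\in[2,\Lambda^T]$: if $\mathcal D^T_{t-1}=0$ then $(\mathcal X^T_t,\mathcal D^T_t)=(\mathcal X^T_{t-1},0)$ with probability 1; if $\mathcal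 D^T_{t-1}\ne0$ then $(\mathcal X^T_t,\mathcal D^T_t)=(X^T_t,D^T_t)$ with probability $D^T_{t-1}/D^T_t$ and $(X^T_t,0)$ with probability $1-D^T_{t-1}/D^T_t$; for $t\ge\Lambda^T+1$: $(\mathcal X^T_t,\mathcal D^T_t)=(\mathcal X^T_{\Lambda^T},0)$ if $\mathcal D^T_{\Lambda^T}=0$, and $=(U,U)$ if $\mathcal D^T_{\Lambda^T}=U$. Laws: $\mathcal Z^T$ is the probability measure on the integers in $[1,\Lambda^T]$ with $\mathcal Z^T(t)=\big(1-\frac{D^T_{t-1}}{D^T_t}\big)\frac{\mu}{D^T_{t-1}}$ for $t\in[1,\Lambda^T-1]$ and $\mathcal Z^T(\Lambda^T)=\frac{\mu}{D^T_{\Lambda^T-1}}$, where $\mu/D^T_0$ is read as $1$ (also when $\mu=0$). $\mathcal Y^T$ is the probability measure on $\{0,U\}$ with $\mathcal Y^T(U)=\frac{D^T_{\Lambda^T-1}}{U}$, $\mathcal Y^T(0)=1-\frac{D^T_{\Lambda^T-1}}{U}$. *)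

(* Defs.v *)
From HB Require Import structures.
From mathcomp Require Import all_boot all_order all_algebra.
From mathcomp Require Import all_classical all_reals all_analysis.

Set Implicit Arguments.
Unset Strict Implicit.
Unset Printing Implicit Defensive.

Import Order.TTheory GRing.Theory Num.Theory.
Local Open Scope classical_set_scope.
Local Open Scope ring_scope.

(* The rationals with their discrete sigma-algebra. *)
HB.instance Definition _ := @isMeasurable.Build default_measure_display
  rat discrete_measurable discrete_measurable0
  discrete_measurableC discrete_measurableU.

(* All deterministic quantities are rational and are computed in [rat]; masses
   are sent to the realType R of the probability measures by [ratr]. *)

Section quantities.
Context (U b : rat).

(* A^T_j for j in [-1, T]; the product over k = j+1, ..., T-1 is a product
   over the natural numbers k < T with j < k. *)
Definition Aval (T : nat) (j : int) : rat :=
  if j == T%:Z then (b + T%:R) / T%:R * U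
  else U * \prod_(0 <= k < T | (j < k%:Z)%R) (k%:R / (b + k%:R)).

Definition Bval (T : nat) (j : int) : rat := j%:~R / (b + T%:R) * Aval T j.

(* The index g stands for j + 1, where j ranges over [-1, T-1]; for
   0 < mu <= U exactly one g qualifies. *)
Definition Gam (T : nat) (mu : rat) : nat :=
  if mu == 0 then 0%N
  else if [pick g : 'I_T.+1 | Aval T.+1 (g%:Z - 1) < mu <= Aval T.+1 g%:Z]
       is Some g then g : nat else 0%N.

Definition chiMAR (T : nat) (mu : rat) : rat := Bval T (Gam T mu)%:Z.

(* Mass function of p * delta_u + p' * delta_v. *)
Definition two_point (S : eqType) (u : S) (p : rat) (v : S) (p' : rat) (y : S)
  : rat := p * (y == u)%:R + p' * (y == v)%:R.

(* Mass function of q^T_{x,mu}, for x, mu in [0, U].  The index i stands for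
   j + 1; as A^T_{T-1} = B^T_T = U, for mu > 0 and x < U the relevant i and k
   exist (and are unique) below T.  The zero values are never reached. *)
Definition qlaw (T : nat) (x mu : rat) : rat -> rat :=
  if (mu == 0) || (x == U) then
    two_point 0 (1 - mu / U) U (mu / U)
  else if [pick i : 'I_T | Aval T (i%:Z - 1) < mu <= Aval T i%:Z] is Some i then
    let A0 := Aval T (i%:Z - 1) in
    let A1 := Aval T i%:Z in
    if 0 <= x < Bval T i%:Z then
      two_point A0 ((A1 - mu) / (A1 - A0)) A1 ((mu - A0) / (A1 - A0))
    else if [pick k : 'I_T | (i <= k)%N &&
                             (Bval T k%:Z <= x < Bval T (k%:Z + 1))] is Some k
    then two_point 0 (1 - mu / Aval T k%:Z) (Aval T k%:Z) (mu / Aval T k%:Z)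
    else fun=> 0
  else fun=> 0.

(* One-based access: [entry d t] is d_t for t in [1, size d]. *)
Definition entry (d : seq rat) (t : nat) : rat := nth 0 d t.-1.

(* [xhat T mu x0 t d] is the order of period t >= 1; it reads only
   d_1, ..., d_{t-1}. *)
Fixpoint xhat (T : nat) (mu x0 : rat) (t : nat) (d : seq rat) {struct t} : rat :=
  match t with
  | 0 => x0
  | s.+1 => if s == 0%N then Num.max x0 (chiMAR T mu)
            else Num.max (xhat T mu x0 s d - entry d s)
                         (chiMAR (T - s) (entry d s))
  end.

Definition Lam (T : nat) (mu : rat) : nat := maxn (T - Gam T mu) 1.

Definition Dval (T : nat) (mu : rat) (t : nat) : rat :=
  if t == 0%N then mu else Aval (T + 1 - t) (minn (Gam T mu) (T - 1))%:Z.

Definition Xval (T : nat) (mu : rat) (t : nat) : rat :=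
  Bval (T + 1 - t) (Gam T mu)%:Z.

(* mu / D^T_t, with the convention mu / D^T_0 = 1 even when mu = 0. *)
Definition mu_over_D (T : nat) (mu : rat) (t : nat) : rat :=
  if t == 0%N then 1 else mu / Dval T mu t.

Definition Zlaw (T : nat) (mu : rat) (t : nat) : rat :=
  if (1 <= t <= Lam T mu - 1)%N then
    (1 - Dval T mu t.-1 / Dval T mu t) * mu_over_D T mu t.-1
  else if t == Lam T mu then mu_over_D T mu (Lam T mu - 1)
  else 0.

Definition Ylaw (T : nat) (mu : rat) : rat -> rat :=
  two_point U (Dval T mu (Lam T mu - 1) / U)
            0 (1 - Dval T mu (Lam T mu - 1) / U).

(* Law of M^T(1), and transition law of M^T from time t - 1 to time t, for
   t in [2, Lam T mu]. *)
Definition Minit (T : nat) (mu : rat) : rat * rat -> rat :=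
  two_point (Xval T mu 1, Dval T mu 1) (mu / Dval T mu 1)
            (Xval T mu 1, 0) (1 - mu / Dval T mu 1).

Definition Mtrans (T : nat) (mu : rat) (t : nat) (m : rat * rat)
  : rat * rat -> rat :=
  if m.2 == 0 then fun m' => (m' == (m.1, 0))%:R
  else two_point
    (Xval T mu t, Dval T mu t) (Dval T mu t.-1 / Dval T mu t)
    (Xval T mu t, 0) (1 - Dval T mu t.-1 / Dval T mu t).

End quantities.

Section probability_notions.
Context (d : measure_display) (Omega : measurableType d) (R : realType)
        (P : probability Omega R).

Definition cprob (E F : set Omega) : R := fine (P (E `&` F)) / fine (P F).

Definition has_pmf (S : Type) (X : Omega -> S) (p : S -> rat) : Prop :=
  forall y : S, P [set w | X w = y] = (ratr (p y))%:E.

Definition independent_RV (d1 d2 : measure_display) (S1 : measurableType d1)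
    (S2 : measurableType d2) (X : {RV P >-> S1}) (Y : {RV P >-> S2}) : Prop :=
  forall (E : set S1) (F : set S2), measurable E -> measurable F ->
    P ((X @^-1` E) `&` (Y @^-1` F)) = (P (X @^-1` E) * P (Y @^-1` F))%E.

(* Markov property of a process indexed by t >= 1 (its entry at index 0 is
   ignored), for discrete state spaces. *)
Definition is_markov (S : Type) (M : nat -> Omega -> S) : Prop :=
  forall (t : nat) (m : nat -> S), (2 <= t)%N ->
    let past := [set w | forall s, (1 <= s <= t - 1)%N -> M s w = m s] in
    (0 < P past)%E ->
    cprob [set w | M t w = m t] past =
    cprob [set w | M t w = m t] [set w | M (t - 1)%N w = m (t - 1)%N].

Definition is_MT (U b : rat) (T : nat) (mu : rat)
    (M : nat -> {RV P >-> (rat * rat)%type}) : Prop :=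
  [/\ is_markov M,
      has_pmf (M 1%N) (Minit U b T mu),
      forall (t : nat) (m m' : rat * rat), (2 <= t <= Lam U b T mu)%N ->
        (0 < P [set w | M (t - 1)%N w = m])%E ->
        cprob [set w | M t w = m'] [set w | M (t - 1)%N w = m] =
        ratr (Mtrans U b T mu t m m')
    & forall t : nat, (Lam U b T mu + 1 <= t)%N ->
        {ae P, forall w,
          ((M (Lam U b T mu) w).2 = 0 ->
             M t w = ((M (Lam U b T mu) w).1, 0)) /\
          ((M (Lam U b T mu) w).2 = U -> M t w = (U, U))}].

End probability_notions.

(* Q is the measure Qhat^* on [0,U]_Q^T: prescribed first marginal, and
   prescribed conditional law of coordinate t + 1 given any value
   (d_1, ..., d_t) of positive probability of the first t coordinates. *)
Definition is_Qhat (R : realType) (U b : rat) (T : nat) (mu x0 : rat)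
    (Q : probability (T.-tuple rat) R) : Prop :=
  [/\ Q [set e | forall t, (1 <= t <= T)%N -> 0 <= entry e t <= U] = 1%E,
      has_pmf Q (fun e => entry e 1)
        (qlaw U b T (xhat U b T mu x0 1 [::]) mu)
    & forall (t : nat) (d : seq rat) (a : rat), (1 <= t <= T - 1)%N ->
        size d = t ->
        (0 < Q [set e | take t e = d])%E ->
        cprob Q [set e | entry e t.+1 = a] [set e | take t e = d] =
        ratr (qlaw U b (T - t) (xhat U b T mu x0 t.+1 d) (entry d t) a)].

(* Main.v *)
Require Import Defs.
From HB Require Import structures.
From mathcomp Require Import all_boot all_order all_algebra.
From mathcomp Require Import all_classical all_reals all_analysis.
From mathcomp Require Import ring zify.

Set Implicit Arguments.
Unset Strict Implicit.
Unset Printing Implicit Defensive.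

Import Order.TTheory GRing.Theory Num.Theory.
Local Open Scope classical_set_scope.
Local Open Scope ring_scope.

(** Write g for the index of the cell (A^{T+1}_{g-1}, A^{T+1}_g] that contains
    mu, with g = 0 if mu = 0.  The point of the proof is that g survives the
    recursion.  At the order B^n_g, where g is the index of the current demand x
    for the horizon n, Nature's law is a coin between 0 and A^n_g, or between 0
    and U when g = n ([qlaw_chiMAR]).  If the nonzero value A^n_g comes out, it
    is the right end of the cell of index g for the next horizon n - 1, so the
    policy orders B^{n-1}_g next ([Gam_Dval], [XvalS_chi]).  This next order is
    the binding one in the maximum, because B^n_g decreases in n and the demand
    has only lowered the stock ([state_order]).  The values of the successive
    coins are therefore the deterministic D_t, the orders are the deterministic
    X_t, and nonzero demand climbs to U at time L = Lambda; from then on both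
    order and demand stay at U.  Once demand is 0 it stays 0, the next target is
    B_0 = 0, and the stock is never consumed, so order and demand are frozen.

    Hence a path is determined by the time at which it dies, if it dies.  Take Z
    and Y independent, on the finite space of pairs with the product weights: Z
    is the death time when Z < L, and at Z = L the variable Y decides between
    death at L and eternal survival.  Everything else is a function of the pair:
    [alive] says whether the path survives t, [state] gives (order, demand) at
    t.  The assertions (a)-(e), the policy recursion and the absorption after L
    hold on every path, by case analysis on the definition.

    What remains are laws.  A telescoping sum ([Zlaw_tail]) shows that a path
    survives t with probability mu / D_t for 1 <= t <= L ([prob_survivors]), so
    the probability of surviving one more step is D_t / D_{t+1}, with D_0 = mu
    for the first one ([prob_branch]).  Each conditioning event that occurs in
    the definitions of the chain and of the measure Qhat, if it has positive
    probability, is of one of two kinds.  If the last demand is nonzero, the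
    event is exactly survival up to t, because survivors share one history; the
    conditional law is then the coin of [prob_branch], or a sure U after L.  If
    the last demand is 0, the next value is certain ([cprob_sure]). *)

(** * Thresholds *)

Lemma two_pointC (S : eqType) (u v : S) p q :
  two_point u p v q =1 two_point v q u p.
Proof. by move=> y; rewrite /two_point addrC. Qed.

Section thresholds.
Context (U b : rat).

Lemma Aval_nat n j : (j < n)%N ->
  Aval U b n j%:Z = U * \prod_(j.+1 <= k < n) (k%:R / (b + k%:R)).
Proof.
move=> jn; rewrite /Aval eqz_nat ltn_eqF//; congr (_ * _).
rewrite (@big_cat_nat _ _ _ j.+1)//= big_nat_cond big_pred0; last first.
  by move=> k; rewrite ltz_nat; lia.
rewrite mul1r big_nat_cond [RHS]big_nat_cond; apply: eq_bigl => k.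
by rewrite ltz_nat; lia.
Qed.

Lemma Aval_pred n : Aval U b n.+1 n%:Z = U.
Proof. by rewrite Aval_nat// big_geq// mulr1. Qed.

Lemma Aval_first n : (0 < n)%N -> Aval U b n (0%:Z - 1) = 0.
Proof.
by case: n => // n _; rewrite /Aval /= big_ltn_cond//= mul0r mul0r mulr0.
Qed.

Lemma Aval_predS n (i : nat) : Aval U b n (i.+1%:Z - 1) = Aval U b n i%:Z.
Proof. by congr (Aval _ _ _ _); rewrite -addn1 PoszD addrK. Qed.

Lemma Bval0 n : Bval U b n 0 = 0.
Proof. by rewrite /Bval mul0r mul0r. Qed.

Lemma Gam_le n x : (Gam U b n x <= n)%N.
Proof.
by rewrite /Gam; case: ifP => // _; case: pickP => // i _; rewrite -ltnS.
Qed.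

Lemma Gam0 n : Gam U b n 0 = 0%N.
Proof. by rewrite /Gam eqxx. Qed.

Lemma chiMAR0 n : chiMAR U b n 0 = 0.
Proof. by rewrite /chiMAR Gam0 Bval0. Qed.

Lemma qlaw_zero n x y : qlaw U b n x 0 y = (y == 0)%:R.
Proof. by rewrite /qlaw eqxx /= /two_point !mul0r addr0 subr0 mul1r. Qed.

Hypotheses (U_gt0 : 0 < U) (b_gt0 : 0 < b).

Lemma bD_gt0 (n : nat) : 0 < b + n%:R.
Proof. by rewrite ltr_pwDl. Qed.

Lemma ratio_Aval_diag n : (0 < n)%N ->
  n%:R / (b + n%:R) * Aval U b n n%:Z = U.
Proof.
move=> n0; rewrite /Aval eqxx; have := bD_gt0 n => bn0.
by field; rewrite (gt_eqF bn0) andbT pnatr_eq0 -lt0n.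
Qed.

(** The product defining A^{n+1}_j has one more factor than that of A^n_j; the
    exceptional value A^n_n is what makes this hold for j = n as well. *)
Lemma Aval_horizonS n j : (0 < n)%N -> (j <= n)%N ->
  Aval U b n.+1 j%:Z = n%:R / (b + n%:R) * Aval U b n j%:Z.
Proof.
move=> n0; rewrite leq_eqVlt => /predU1P[->|jn].
  by rewrite Aval_pred ratio_Aval_diag.
by rewrite !Aval_nat ?(leqW jn)// big_nat_recr//=; ring.
Qed.

Lemma Aval_succ n j : (j < n)%N ->
  Aval U b n j%:Z = j.+1%:R / (b + j.+1%:R) * Aval U b n j.+1%:Z.
Proof.
move=> jn; move: (jn); rewrite leq_eqVlt => /predU1P[<-|jn'].
  by rewrite Aval_pred ratio_Aval_diag.
by rewrite !Aval_nat// big_ltn//; ring.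
Qed.

Lemma Aval_gt0 n j : (0 < n)%N -> (j <= n)%N -> 0 < Aval U b n j%:Z.
Proof.
move=> n0; rewrite leq_eqVlt => /predU1P[->|jn].
  by rewrite /Aval eqxx mulr_gt0// divr_gt0 ?bD_gt0// ltr0n.
rewrite Aval_nat// mulr_gt0// big_nat_cond prodr_gt0//.
move=> k /andP[/andP[jk _] _].
by rewrite divr_gt0 ?bD_gt0// ltr0n (leq_ltn_trans _ jk).
Qed.

Lemma ratio_lt1 n : n%:R / (b + n%:R) < 1 :> rat.
Proof. by rewrite ltr_pdivrMr ?bD_gt0// mul1r ltrDr. Qed.

Lemma Aval_lt n j k : (j < k)%N -> (k <= n)%N ->
  Aval U b n j%:Z < Aval U b n k%:Z.
Proof.
move=> + kn; elim: k kn => // k IH kn; rewrite ltnS leq_eqVlt.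
have Ak : Aval U b n k%:Z < Aval U b n k.+1%:Z.
  by rewrite Aval_succ// gtr_pMl ?ratio_lt1// Aval_gt0//; lia.
by move=> /predU1P[->//|jk]; apply: lt_trans Ak; apply: IH => //; exact: ltnW.
Qed.

Lemma Aval_le n j k : (j <= k)%N -> (k <= n)%N ->
  Aval U b n j%:Z <= Aval U b n k%:Z.
Proof.
rewrite leq_eqVlt => /predU1P[->//|jk kn]; exact/ltW/Aval_lt.
Qed.

Lemma Aval_leU n j : (j < n)%N -> Aval U b n j%:Z <= U.
Proof.
by case: n => // n jn; rewrite -[leRHS](Aval_pred n); exact: Aval_le.
Qed.

Lemma Aval_horizon_lt n j : (0 < n)%N -> (j <= n)%N ->
  Aval U b n.+1 j%:Z < Aval U b n j%:Z.
Proof.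
by move=> n0 jn; rewrite Aval_horizonS// gtr_pMl ?ratio_lt1// Aval_gt0.
Qed.

Lemma Bval_diag n : (0 < n)%N -> Bval U b n n%:Z = U.
Proof. exact: ratio_Aval_diag. Qed.

Lemma Bval_ge0 n j : (0 < n)%N -> (j <= n)%N -> 0 <= Bval U b n j%:Z.
Proof.
move=> n0 jn; rewrite /Bval mulr_ge0 ?divr_ge0//.
  exact/ltW/bD_gt0.
exact/ltW/Aval_gt0.
Qed.

Lemma Bval_lt n j k : (j < k)%N -> (k <= n)%N ->
  Bval U b n j%:Z < Bval U b n k%:Z.
Proof.
move=> jk kn; rewrite !/Bval.
have n0 : (0 < n)%N by lia.
rewrite ltr_pM ?divr_ge0 ?(ltW (bD_gt0 n))//.
- by apply/ltW/Aval_gt0; lia.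
- by rewrite ltr_pM2r ?invr_gt0 ?bD_gt0// ltr_nat.
- exact: Aval_lt.
Qed.

Lemma Bval_le n j k : (j <= k)%N -> (k <= n)%N ->
  Bval U b n j%:Z <= Bval U b n k%:Z.
Proof.
rewrite leq_eqVlt => /predU1P[->//|jk kn]; exact/ltW/Bval_lt.
Qed.

(** Both factors j / (b + n) and A^n_j decrease in the horizon n: a shorter
    horizon asks for a larger stock. *)
Lemma Bval_horizon_le n j : (0 < n)%N -> (j <= n)%N ->
  Bval U b n.+1 j%:Z <= Bval U b n j%:Z.
Proof.
move=> n0 jn; rewrite !/Bval.
apply: ler_pM.
- by rewrite divr_ge0 ?(ltW (bD_gt0 _)).
- by apply/ltW/Aval_gt0; lia.
- rewrite ler_wpM2l// lef_pV2 ?posrE ?bD_gt0//; apply: lerD => //.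
  by rewrite ler_nat.
- exact/ltW/Aval_horizon_lt.
Qed.

Lemma cell_le n (i k : nat) (x : rat) : (k <= n)%N -> (i <= n)%N ->
  Aval U b n (i%:Z - 1) < x -> x <= Aval U b n k%:Z -> (i <= k)%N.
Proof.
move=> kn i_n Aix xAk; rewrite leqNgt; apply/negP => ki.
case: i ki Aix i_n => // i ki; rewrite Aval_predS => /lt_le_trans/(_ xAk).
by move=> /[swap] i_n; rewrite ltNge Aval_le// ltnW.
Qed.

Lemma cell_uniq n (i k : nat) (x : rat) : (i <= n)%N -> (k <= n)%N ->
  Aval U b n (i%:Z - 1) < x <= Aval U b n i%:Z ->
  Aval U b n (k%:Z - 1) < x <= Aval U b n k%:Z -> i = k.
Proof.
move=> i_n kn /andP[i1 i2] /andP[k1 k2]; apply/eqP; rewrite eqn_leq.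
by rewrite (cell_le kn i_n i1 k2) (cell_le i_n kn k1 i2).
Qed.

(** As A^n_{-1} = 0, the cells cover (0, A^n_h]; take the first threshold that
    is at least x. *)
Lemma cell_exists n h (x : rat) : (0 < n)%N -> (h <= n)%N ->
  0 < x <= Aval U b n h%:Z ->
  exists2 i, (i <= h)%N & Aval U b n (i%:Z - 1) < x <= Aval U b n i%:Z.
Proof.
move=> n0 hn /andP[x0 xAh].
have exi : exists i, x <= Aval U b n i%:Z by exists h.
case: (ex_minnP exi) => i xAi mini; exists i; first exact: mini.
rewrite xAi andbT; case: i mini xAi => [_ _|i mini _].
  by rewrite Aval_first.
by rewrite Aval_predS ltNge; apply/negP => /mini; rewrite ltnn.
Qed.

Lemma Gam_eq n g (x : rat) : 0 < x -> (g <= n)%N ->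
  Aval U b n.+1 (g%:Z - 1) < x <= Aval U b n.+1 g%:Z -> Gam U b n x = g.
Proof.
move=> x0 gn gx; rewrite /Gam gt_eqF//.
case: pickP => [i ix|/(_ (Ordinal (gn : g < n.+1)%N))].
  by apply: (@cell_uniq n.+1 _ _ x) => //; [exact/ltnW/ltn_ord|exact: ltnW].
by rewrite /= gx.
Qed.

Lemma GamP n (x : rat) : 0 < x <= U ->
  Aval U b n.+1 ((Gam U b n x)%:Z - 1) < x <= Aval U b n.+1 (Gam U b n x)%:Z.
Proof.
move=> /andP[x0 xU].
have [|i i_n ix] := @cell_exists n.+1 n x isT (leqnSn n).
  by rewrite x0 Aval_pred.
by rewrite (Gam_eq x0 i_n ix).
Qed.

Lemma GamA n g : (g <= n)%N -> Gam U b n (Aval U b n.+1 g%:Z) = g.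
Proof.
move=> gn; have A0 : 0 < Aval U b n.+1 g%:Z by rewrite Aval_gt0// ltnW.
apply: Gam_eq => //; rewrite lexx andbT.
case: g gn A0 => [|g] gn A0; first by rewrite Aval_first.
by rewrite Aval_predS Aval_lt// ltnW.
Qed.

Lemma chiMAR_U n : (0 < n)%N -> chiMAR U b n U = U.
Proof.
by move=> n0; rewrite /chiMAR -[X in Gam _ _ _ X](Aval_pred n) GamA// Bval_diag.
Qed.

Lemma qlaw_cap n y : qlaw U b n U U y = (y == U)%:R.
Proof.
by rewrite /qlaw eqxx orbT /= /two_point divff ?lt0r_neq0 //
  subrr mul0r mul1r add0r.
Qed.

(** At the order B^n_g Nature's law is never of type (i).  The cell of x for
    the horizon n has an index i <= g, since A^n_g > A^{n+1}_g >= x, so that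
    B^n_i <= B^n_g rules out (i); in type (ii) the index k is g itself.  For
    g = n the order is U, which is type (iii), and minn g (n - 1) selects
    A^n_{n-1} = U. *)
Lemma qlaw_chiMAR n (x y : rat) : (0 < n)%N -> 0 <= x <= U ->
  let A := Aval U b n (minn (Gam U b n x) (n - 1))%:Z in
  qlaw U b n (chiMAR U b n x) x y = two_point A (x / A) 0 (1 - x / A) y.
Proof.
move=> n0 /andP[x_ge0 xU] A; rewrite two_pointC /chiMAR.
have [->|xneq0] := eqVneq x 0.
  by rewrite qlaw_zero /two_point !mul0r addr0 subr0 mul1r.
have x0 : 0 < x by rewrite lt_neqAle eq_sym xneq0.
rewrite /A /qlaw (negbTE xneq0)/=; set g := Gam U b n x.
have gn : (g <= n)%N := Gam_le n x.
have /andP[_ xAg] : Aval U b n.+1 (g%:Z - 1) < x <= Aval U b n.+1 g%:Z.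
  by apply: GamP; rewrite x0.
have [gn'|gn'] := eqVneq g n.
  rewrite gn' Bval_diag// eqxx (minn_idPr _) ?leq_subr//.
  by rewrite -[X in Aval _ _ X](prednK n0) subn1 Aval_pred.
have {gn gn'}gn : (g < n)%N by rewrite ltn_neqAle gn' gn.
rewrite (minn_idPl _); last by lia.
have -> : (Bval U b n g%:Z == U) = false.
  by rewrite -[X in _ == X](Bval_diag n0) lt_eqF ?Bval_lt.
have {}xAg : x <= Aval U b n g%:Z.
  by rewrite (le_trans xAg)// ltW// Aval_horizon_lt// ltnW.
have [|i ig ix] := @cell_exists n g x n0 (ltnW gn); first by rewrite x0.
case: pickP => [i' /andP[i'x _]|]; last first.
  move=> /(_ (Ordinal (leq_ltn_trans ig gn))).
  by rewrite /= ix.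
have {i ig ix} ig : (i' <= g)%N by apply: cell_le i'x xAg => //; exact/ltnW.
rewrite ltNge Bval_le ?andbF//; last exact: ltnW.
have Skn (k : nat) : k%:Z + 1 = k.+1%:Z by rewrite -addn1.
case: pickP => [k|/(_ (Ordinal gn))]; last first.
  by rewrite /= ig lexx Skn Bval_lt.
rewrite Skn => /andP[_ /andP[kg gk]].
suff -> : k = g :> nat by [].
apply/eqP; rewrite eqn_leq; apply/andP.
split; rewrite leqNgt; apply/negP => gk'.
- by move: kg; rewrite leNgt Bval_lt// ltnW.
- by move: gk; rewrite ltNge Bval_le// ltnW.
Qed.

End thresholds.

(** * The deterministic surviving path *)

Section path.
Context (U b : rat) (T : nat) (mu : rat).

Local Notation g := (Gam U b T mu).
Local Notation L := (Lam U b T mu).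
Local Notation D := (Dval U b T mu).
Local Notation X := (Xval U b T mu).
Local Notation surv := (mu_over_D U b T mu).

Lemma Lam_gt0 : (0 < L)%N. Proof. exact: leq_maxr. Qed.

Lemma DvalS t : D t.+1 = Aval U b (T - t) (minn g (T - 1))%:Z.
Proof. by rewrite /Dval; congr Aval; rewrite addn1 subSS. Qed.

Lemma XvalS t : X t.+1 = Bval U b (T - t) g%:Z.
Proof. by rewrite /Xval; congr Bval; rewrite addn1 subSS. Qed.

(** Survival of period t.  Before L death comes at time z; a path that reaches
    z = L dies there or lives forever, as the coin y decides. *)
Definition alive (t z : nat) (y : bool) : bool :=
  if (t < L)%N then (t < z)%N else (z == L) && y.

(** Order and demand of period t.  The order of a dead path is that of the
    period z in which it died. *)
Definition state (t z : nat) (y : bool) : rat * rat :=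
  if alive t z y then if (t <= L)%N then (X t, D t) else (U, U)
  else (X z, 0).

Lemma alive0 z y : (0 < z)%N -> alive 0 z y.
Proof. by rewrite /alive Lam_gt0. Qed.

Lemma alive_le s t z y : (s <= t)%N -> alive t z y -> alive s z y.
Proof.
move=> st; rewrite /alive; case: (ltnP t L) => tL; case: (ltnP s L) => sL //.
- exact: leq_ltn_trans.
- by lia.
- by move=> /andP[/eqP-> _]; lia.
Qed.

Lemma aliveS_cap t z y : (L <= t)%N -> alive t.+1 z y = alive t z y.
Proof. by move=> Lt; rewrite /alive !ltnNge Lt leqW. Qed.

Lemma state_alive t z y : alive t z y ->
  state t z y = if (t <= L)%N then (X t, D t) else (U, U).
Proof. by rewrite /state => ->. Qed.

Lemma state_dead t z y : ~~ alive t z y -> state t z y = (X z, 0).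
Proof. by rewrite /state => /negbTE->. Qed.

Lemma state_step_dead t z y : ~~ alive t z y -> state t.+1 z y = state t z y.
Proof.
move=> dead; rewrite !state_dead//.
by apply: contra dead; apply: alive_le.
Qed.

Lemma state_step_cap t z y : (L <= t)%N -> alive t z y ->
  state t.+1 z y = (U, U).
Proof.
by move=> Lt al; rewrite state_alive ?aliveS_cap// leqNgt ltnS Lt.
Qed.

(** Death in period t + 1 happens at the order X_{t+1} that survival would
    have led to. *)
Lemma state_step t z y : (t < L)%N -> (z <= L)%N -> alive t z y ->
  state t.+1 z y = (X t.+1, if alive t.+1 z y then D t.+1 else 0).
Proof.
move=> tL zL al; rewrite /state tL; case: ifP => // /negbT dead.
congr (X _, _); move: al dead; rewrite /alive tL; case: ifP; first by lia.
by lia.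
Qed.

Hypothesis T_gt0 : (0 < T)%N.

Lemma Lam_leT : (L <= T)%N. Proof. by rewrite /Lam; lia. Qed.

Lemma Dval_Lam : D L = U.
Proof.
rewrite -(prednK Lam_gt0) DvalS.
have := Gam_le U b T mu; rewrite /Lam => gT.
have -> : (T - (maxn (T - g) 1).-1 = (minn g (T - 1)).+1)%N by lia.
exact: Aval_pred.
Qed.

Hypotheses (U_gt0 : 0 < U) (b_gt0 : 0 < b).

Lemma Dval_gt0 t : (0 < t <= L)%N -> 0 < D t.
Proof.
case: t => // t; rewrite DvalS /Lam => tL; have := Gam_le U b T mu => gT.
by apply: Aval_gt0 => //; lia.
Qed.

(** The index is kept along the surviving path: D_t is the right end of the
    cell of index g for the horizon T - t, and D_0 = mu lies in that cell by the
    choice of g. *)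
Lemma Gam_Dval t : (t < L)%N -> Gam U b (T - t) (D t) = g.
Proof.
case: t => [|t]; first by rewrite subn0.
rewrite DvalS /Lam => tL; have gT := Gam_le U b T mu.
have -> : minn g (T - 1) = g by lia.
have -> : (T - t = (T - t.+1).+1)%N by lia.
by rewrite GamA//; lia.
Qed.

Lemma XvalS_chi t : (t < L)%N -> X t.+1 = chiMAR U b (T - t) (D t).
Proof. by move=> tL; rewrite /chiMAR Gam_Dval// XvalS. Qed.

Lemma Xval_bnd t : (0 < t <= L)%N -> 0 <= X t <= U.
Proof.
case: t => // t tL; rewrite XvalS.
have gT := Gam_le U b T mu; have Tt0 : (0 < T - t)%N by have := Lam_leT; lia.
have gTt : (g <= T - t)%N by move: tL; rewrite /Lam; lia.
by rewrite Bval_ge0//= -[leRHS](@Bval_diag U b _ (T - t))// Bval_le.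
Qed.

Lemma Xval_leS t : (0 < t < L)%N -> X t <= X t.+1.
Proof.
case: t => // t; rewrite /Lam !XvalS => tL; have gT := Gam_le U b T mu.
have -> : (T - t = (T - t.+1).+1)%N by lia.
by apply: Bval_horizon_le => //; lia.
Qed.

Hypothesis mu_bnd : 0 <= mu <= U.

Lemma Dval_bnd t : (t <= L)%N -> 0 <= D t <= U.
Proof.
case: t => [//|t] tL; rewrite ltW ?Dval_gt0//= DvalS.
have := Gam_le U b T mu => gT; move: tL; rewrite /Lam => tL.
by apply: Aval_leU => //; lia.
Qed.

Lemma qlaw_path t y : (t < L)%N ->
  qlaw U b (T - t) (X t.+1) (D t) y =
  two_point (D t.+1) (D t / D t.+1) 0 (1 - D t / D t.+1) y.
Proof.
move=> tL; rewrite XvalS_chi// qlaw_chiMAR//; last 2 first.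
- by have := Lam_leT; lia.
- exact/Dval_bnd/ltnW.
rewrite Gam_Dval// DvalS.
suff -> : minn g (T - t - 1) = minn g (T - 1) by [].
move: tL; rewrite /Lam; have := Gam_le U b T mu; lia.
Qed.

(** While g < T - t, D_t is at most A^{T-t+1}_g < A^{T-t}_g = D_{t+1}.  The
    equality g = T - t happens only in the step to D_L = U. *)
Lemma Dval_leS t : (t < L)%N -> D t <= D t.+1.
Proof.
move=> tL; have Tt0 : (0 < T - t)%N by have := Lam_leT; lia.
have /andP[Dt0 DtU] := Dval_bnd (ltnW tL).
have [->|Dt] := eqVneq (D t) 0; first exact/ltW/Dval_gt0.
have := @GamP U b U_gt0 b_gt0 (T - t) (D t).
rewrite Gam_Dval// lt_neqAle eq_sym Dt Dt0 DtU => /(_ isT)/andP[_ DA].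
have gT := Gam_le U b T mu.
have [gt|gt] := ltnP g (T - t).
  rewrite DvalS (_ : minn _ _ = g); last by lia.
  by rewrite (le_trans DA)// ltW// Aval_horizon_lt// ltnW.
suff -> : t.+1 = L by rewrite Dval_Lam.
by move: tL gt; rewrite /Lam; lia.
Qed.

Lemma mu_over_D_ge0 t : (t <= L)%N -> 0 <= surv t.
Proof.
rewrite /mu_over_D; case: eqVneq => // t0 tL.
have /andP[mu0 _] := mu_bnd; have /andP[Dt0 _] := Dval_bnd tL.
exact: divr_ge0.
Qed.

(** Since D_0 = mu, the reading mu / D_0 = 1 makes the first step follow the
    same rule as the others, for mu = 0 as well. *)
Lemma mu_over_DS t : (t < L)%N -> surv t.+1 = surv t * (D t / D t.+1).
Proof.
case: t => [|t] tL; rewrite /mu_over_D//= ?mul1r//.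
by rewrite mulrA divfK// lt0r_neq0// Dval_gt0//= ltnW.
Qed.

Lemma Zlaw_diff t : (t.+1 < L)%N -> Zlaw U b T mu t.+1 = surv t - surv t.+1.
Proof.
move=> tL; rewrite /Zlaw (_ : (1 <= t.+1 <= L - 1)%N) /=; last by lia.
rewrite mu_over_DS ?(ltnW tL)//; ring.
Qed.

Lemma Zlaw_last : Zlaw U b T mu L = surv L.-1.
Proof.
rewrite /Zlaw eqxx subn1 Lam_gt0 /=.
by rewrite -[X in (X <= _)%N](prednK Lam_gt0) ltnn.
Qed.

Lemma Zlaw_ge0 t : 0 <= Zlaw U b T mu t.
Proof.
have [t0|t0] := posnP t.
  by rewrite t0 /Zlaw/= eq_sym (gtn_eqF Lam_gt0).
have [tL|Lt|->] := ltngtP t L.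
- rewrite -(prednK t0) in tL *; rewrite Zlaw_diff// subr_ge0.
  rewrite mu_over_DS ?(ltnW tL)// ler_piMr//.
    exact/mu_over_D_ge0/ltnW/ltnW.
  by rewrite ler_pdivrMr ?mul1r ?Dval_leS ?Dval_gt0//= ltnW.
- by rewrite /Zlaw gtn_eqF// t0 leqNgt (_ : (L - 1 < t)%N)//; lia.
- by rewrite Zlaw_last mu_over_D_ge0// leq_pred.
Qed.

(** The tail P(Z > t) of Z; the sum telescopes by [Zlaw_diff]. *)
Lemma Zlaw_tail t : (t < L)%N -> \sum_(t <= i < L) Zlaw U b T mu i.+1 = surv t.
Proof.
move=> tL; rewrite -(prednK Lam_gt0) big_nat_recr/=; last first.
  by rewrite -ltnS prednK ?Lam_gt0.
rewrite prednK ?Lam_gt0// Zlaw_last.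
rewrite (eq_big_nat _ _ (F2 := fun i => - surv i.+1 - - surv i)); last first.
  by move=> i iL; rewrite Zlaw_diff ?opprK 1?addrC//; lia.
by rewrite telescope_sumr; [rewrite opprK addrAC addNr add0r|lia].
Qed.

Lemma state2_eq0 t z y : (0 < t)%N -> ((state t z y).2 == 0) = ~~ alive t z y.
Proof.
move=> t0; rewrite /state; case: ifP => al; last by rewrite eqxx.
case: ifP => tL /=; last exact/negbTE/lt0r_neq0.
by apply/negbTE/lt0r_neq0/Dval_gt0; rewrite t0.
Qed.

Lemma state2_cap t z y : (L <= t)%N -> (state t z y).2 = U * (alive t z y)%:R.
Proof.
move=> Lt; rewrite /state; case: ifP => _; last by rewrite mulr0.
by case: leqP => tL /=; rewrite mulr1// (_ : t = L) ?Dval_Lam//; lia.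
Qed.

Lemma state_bnd t z y : (0 < t)%N -> (0 < z <= L)%N ->
  (0 <= (state t z y).1 <= U) /\ (0 <= (state t z y).2 <= U).
Proof.
move=> t0 zL; rewrite /state; have U0 := ltW U_gt0.
case: ifP => _; last by rewrite /= Xval_bnd// lexx.
by case: ifP => tL /=; rewrite ?U0 ?lexx// Xval_bnd ?t0// Dval_bnd.
Qed.

(** A dead path has chi = 0 and keeps its stock.  On a path alive in period t,
    chi is the next order, and it is the larger one since the orders increase. *)
Lemma state_order t z y : (0 < t < T)%N -> (0 < z <= L)%N ->
  (state t.+1 z y).1 =
  Num.max ((state t z y).1 - (state t z y).2)
          (chiMAR U b (T - t) (state t z y).2).
Proof.
move=> /andP[t0 tT] zL; have [st1 st2] := state_bnd y t0 zL.
have [al|dead] := boolP (alive t z y); last first.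
  rewrite state_step_dead// state_dead//= subr0 chiMAR0 max_l//.
  by have /andP[] := Xval_bnd zL.
have /andP[_ zL'] := zL.
have [tL|Lt] := ltnP t L.
  rewrite state_step// state_alive// (ltnW tL) /= -XvalS_chi// max_r//.
  have /andP[D0 _] := Dval_bnd (ltnW tL).
  by rewrite (le_trans _ (Xval_leS _)) ?t0// gerBl.
rewrite state_step_cap//= state2_cap// al mulr1 chiMAR_U ?subn_gt0// max_r//.
by rewrite lerBlDr; move: st1 => /andP[_ s1]; rewrite (le_trans s1)// lerDl ltW.
Qed.

Lemma xhat_state x0 d t z y : 0 <= x0 <= chiMAR U b T mu -> (0 < z <= L)%N ->
  (0 < t <= T)%N -> (forall s, (0 < s < t)%N -> entry d s = (state s z y).2) ->
  xhat U b T mu x0 t d = (state t z y).1.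
Proof.
move=> /andP[_ x0chi] zL /andP[+ +]; elim: t => // t IH _ tT dE.
have [z0 zL'] := andP zL.
have [->|t0] := posnP t.
  rewrite /= max_r// state_step ?Lam_gt0 ?alive0//=.
  by rewrite XvalS_chi ?Lam_gt0 ?subn0.
rewrite [LHS]/= gtn_eqF// state_order ?t0// IH ?(ltnW tT)//; last first.
  by move=> s st; apply: dE; lia.
by rewrite dE ?t0/=.
Qed.

End path.

(** * Finite probability spaces *)

(** An alias that carries the point [x0], so that the discrete sigma-algebra
    can be attached to any nonempty finite type. *)
Definition finite_space (F : finType) (x0 : F) : Type := F.

HB.instance Definition _ (F : finType) (x0 : F) :=
  Finite.on (finite_space x0).
HB.instance Definition _ (F : finType) (x0 : F) :=
  isPointed.Build (finite_space x0) x0.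
HB.instance Definition _ (F : finType) (x0 : F) :=
  @isMeasurable.Build default_measure_display (finite_space x0)
    discrete_measurable discrete_measurable0
    discrete_measurableC discrete_measurableU.

Section finite_measure.
Context (F : finType) (x0 : F) (p : F -> rat).
Local Notation Omega := (finite_space x0).

(** The weights are rational, and the computations are made before sending
    masses to the reals. *)
Definition mass (A : set Omega) : rat := \sum_(x : F) p x * (x \in A)%:R.

Hypotheses (p_ge0 : forall x, 0 <= p x) (p_sum1 : \sum_x p x = 1).

Lemma mass_setT : mass setT = 1.
Proof.
by rewrite /mass -[RHS]p_sum1; apply: eq_bigr => x _; rewrite in_setT mulr1.
Qed.

(** The measure is a finite sum of weighted Dirac masses. *)
Lemma finite_probability (R : realType) :
  exists P : probability Omega R, forall A, P A = (ratr (mass A))%:E.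
Proof.
have q_ge0 x : 0 <= ratr (p x) :> R by rewrite ler0q.
pose m k : {measure set Omega -> \bar R} :=
  mscale (NngNum (q_ge0 (nth x0 (enum F) k)))
         (dirac (nth x0 (enum F) k : Omega)).
have PE A : msum m #|F| A = (ratr (mass A))%:E.
  rewrite /msum /mass rmorph_sum -sumEFin.
  rewrite (reindex (@enum_val F predT)) /=; last first.
    by exists enum_rank => x _; rewrite ?enum_valK ?enum_rankK.
  rewrite (eq_bigl predT); last by move=> k; rewrite inE.
  apply: eq_bigr => k _.
  rewrite /m /mscale/= diracE -(enum_val_nth x0) -EFinM rmorphM/=.
  by rewrite ratr_nat.
have P1 : msum m #|F| setT = 1%E by rewrite PE mass_setT rmorph1.
pose mP := Measure_isProbability.Build _ _ _ (msum m #|F|) P1.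
pose P : probability Omega R := HB.pack (msum m #|F|) mP.
by exists P.
Qed.

End finite_measure.

Section finite_rv.
Context (F : finType) (x0 : F) (d : measure_display) (S : measurableType d).

(** An alias under which every function is a random variable, the domain being
    discrete. *)
Definition finite_rv (f : F -> S) : finite_space x0 -> S := f.

Lemma measurable_finite_rv f : measurable_fun setT (finite_rv f).
Proof. by []. Qed.

HB.instance Definition _ f := isMeasurableFun.Build _ _ _ _ (finite_rv f)
  (measurable_finite_rv f).

End finite_rv.

(** * Conditioning on a finite space *)

Section finite_conditioning.
Context (F : finType) (x0 : F) (p : F -> rat) (R : realType).
Context (P : probability (finite_space x0) R).
Hypothesis PE : forall A, P A = (ratr (mass p A))%:E.

Lemma finite_gt0 A : (0 < P A)%E = (0 < mass p A).
Proof. by rewrite PE lte_fin ltr0q. Qed.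

Lemma finite_gt0_nonempty A : (0 < P A)%E -> A !=set0.
Proof.
by move=> PA; apply/set0P/eqP => A0; move: PA; rewrite A0 measure0 ltxx.
Qed.

Lemma cprobE A B : cprob P A B = ratr (mass p (A `&` B) / mass p B).
Proof. by rewrite /cprob !PE /= fmorph_div. Qed.

Lemma cprob_sure (S : eqType) (f : F -> S) (c y : S) B : (0 < P B)%E ->
  (forall w, B w -> f w = c) -> cprob P [set w | f w = y] B = ratr (y == c)%:R.
Proof.
move=> PB fc; rewrite cprobE; congr ratr; move: PB; rewrite finite_gt0 => B0.
have [->|yc] := eqVneq y c.
  rewrite (_ : _ `&` B = B) ?divff ?lt0r_neq0//.
  by apply/seteqP; split=> [w []//|w Bw]; split=> //=; exact: fc.
rewrite (_ : _ `&` B = set0); last first.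
  apply/seteqP; split=> // w [/= fy /fc].
  by rewrite fy => /eqP; rewrite (negbTE yc).
by rewrite /mass big1 ?mul0r// => x _; rewrite in_set0 mulr0.
Qed.

End finite_conditioning.

(** * The coupling *)

Section coupling.
Context (U b : rat) (T : nat) (mu : rat).

Local Notation L := (Lam U b T mu).
Local Notation D := (Dval U b T mu).
Local Notation X := (Xval U b T mu).
Local Notation surv := (mu_over_D U b T mu).

(** The first component i stands for Z = i + 1, the second for Y = U. *)
Definition outcome : finType := ('I_L.-1.+1 * bool)%type.
Definition outcome0 : outcome := (ord0, true).

Definition Zof (w : outcome) : nat := w.1.+1.
Definition Yof (y : bool) : rat := if y then U else 0.

Definition weight (w : outcome) : rat :=
  Zlaw U b T mu (Zof w) * Ylaw U b T mu (Yof w.2).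

Local Notation prob := (@mass outcome outcome0 weight).

Lemma Zof_bnd w : (0 < Zof w <= L)%N.
Proof. by rewrite /Zof/= -[leqRHS](prednK (Lam_gt0 U b T mu)). Qed.

Lemma mem_setb (w : finite_space outcome0) (e : pred outcome) :
  (w \in [set w | e w]) = e w.
Proof. by apply/idP/idP; rewrite in_setE. Qed.

(** The weights are products, so rectangles have product mass. *)
Lemma prob_rect (A : set (finite_space outcome0)) (e : pred nat)
    (f : pred bool) :
  (forall w, (w \in A) = e (Zof w) && f w.2) ->
  prob A = (\sum_(0 <= i < L) Zlaw U b T mu i.+1 * (e i.+1)%:R)
         * (\sum_(y : bool) Ylaw U b T mu (Yof y) * (f y)%:R).
Proof.
move=> AE; rewrite /mass -(prednK (Lam_gt0 U b T mu)) big_mkord big_distrlr/=.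
rewrite pair_bigA; apply: eq_bigr => w _.
by rewrite AE /weight -mulnb natrM mulrACA.
Qed.

Hypotheses (U_gt0 : 0 < U) (b_gt0 : 0 < b) (T_gt0 : (0 < T)%N).
Hypothesis (mu_bnd : 0 <= mu <= U).

Lemma YlawE y :
  Ylaw U b T mu (Yof y) = if y then D L.-1 / U else 1 - D L.-1 / U.
Proof.
rewrite /Ylaw /two_point /Yof subn1; case: y;
  rewrite eqxx ?(gt_eqF U_gt0) ?(lt_eqF U_gt0).
  by rewrite mulr1 mulr0 addr0.
by rewrite mulr1 mulr0 add0r.
Qed.

Lemma weight_ge0 w : 0 <= weight w.
Proof.
rewrite mulr_ge0 ?Zlaw_ge0// YlawE.
have /andP[D0 DU] : 0 <= D L.-1 <= U by rewrite Dval_bnd// leq_pred.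
have D1 : D L.-1 / U <= 1 by rewrite ler_pdivrMr// mul1r.
by case: w.2; rewrite ?subr_ge0// divr_ge0// ltW.
Qed.

Lemma Zlaw_total : \sum_(0 <= i < L) Zlaw U b T mu i.+1 * true%:R = 1.
Proof.
under eq_bigr do rewrite mulr1.
by rewrite Zlaw_tail ?Lam_gt0.
Qed.

Lemma Ylaw_total : \sum_(y : bool) Ylaw U b T mu (Yof y) * true%:R = 1.
Proof. by rewrite big_bool !YlawE /= !mulr1 addrC subrK. Qed.

Lemma weight_sum1 : \sum_w weight w = 1.
Proof.
have := @prob_rect setT predT predT; rewrite /=.
rewrite Zlaw_total Ylaw_total mulr1 => <-.
  by rewrite /mass; apply: eq_bigr => w _; rewrite in_setT mulr1.
by move=> w; rewrite in_setT.
Qed.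

Lemma prob_Z z : prob [set w | Zof w = z] = Zlaw U b T mu z.
Proof.
rewrite (@prob_rect _ (pred1 z) predT); last first.
  by move=> w; rewrite andbT; apply/idP/eqP; rewrite in_setE.
rewrite Ylaw_total mulr1.
have [z1|z1] := boolP (0 < z <= L)%N; last first.
  rewrite big_nat_cond big1 => [|i /andP[iL _]]; last first.
    by rewrite /= (_ : (i.+1 == z) = false) ?mulr0//; apply/negbTE; lia.
  by rewrite /Zlaw !ifF//; have := Lam_gt0 U b T mu; lia.
rewrite (bigD1_seq z.-1) ?iota_uniq//=; last by rewrite mem_index_iota; lia.
rewrite prednK ?(andP z1).1// eqxx mulr1 big1 ?addr0// => i iz.
by rewrite (_ : (i.+1 == z) = false) ?mulr0//; apply/negbTE; lia.
Qed.

Lemma prob_Y r : prob [set w | Yof w.2 = r] = Ylaw U b T mu r.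
Proof.
rewrite (@prob_rect _ predT (fun y => Yof y == r)); last first.
  by move=> w; apply/idP/eqP; rewrite in_setE.
rewrite Zlaw_total mul1r big_bool !YlawE /= /Ylaw /two_point subn1.
by rewrite /Yof [U == r]eq_sym [0 == r]eq_sym.
Qed.

Lemma prob_ZY (E : set nat) (G : set rat) :
  prob ([set w | E (Zof w)] `&` [set w | G (Yof w.2)]) =
  prob [set w | E (Zof w)] * prob [set w | G (Yof w.2)].
Proof.
rewrite (@prob_rect _ (mem E) (fun y => Yof y \in G)); last first.
  by move=> w; rewrite in_setI; congr (_ && _).
rewrite (@prob_rect [set w | E _] (mem E) predT); last first.
  by move=> w; rewrite andbT.
rewrite (@prob_rect [set w | G _] predT (fun y => Yof y \in G))//.
by rewrite Ylaw_total Zlaw_total mulr1 mul1r.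
Qed.

Local Notation survivors t :=
  [set w : finite_space outcome0 | alive U b T mu t (Zof w) w.2].
Local Notation statew t w := (state U b T mu t (Zof w) w.2).

(** For t < L survival means Z > t.  From L on it means Z = L and Y = U, with
    probability surv (L - 1) * (D_{L-1} / U) = surv L. *)
Lemma prob_survivors t : prob (survivors t) = surv (minn t L).
Proof.
have [tL|Lt] := ltnP t L.
  rewrite (@prob_rect _ (fun z => (t < z)%N) predT); last first.
    by move=> w; rewrite mem_setb /alive tL andbT.
  rewrite Ylaw_total mulr1 (@big_cat_nat _ _ _ t)//= 1?ltnW// big_nat_cond big1.
    rewrite add0r -[RHS](Zlaw_tail T_gt0 U_gt0 b_gt0 mu_bnd tL).
    by apply: eq_big_nat => i /andP[ti _]; rewrite ltnS ti mulr1.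
  by move=> i /andP[/andP[_ it] _]; rewrite ltnS leqNgt it mulr0.
rewrite (@prob_rect _ (pred1 L) id); last first.
  by move=> w; rewrite mem_setb /alive ltnNge Lt.
rewrite big_bool !YlawE /= mulr1 mulr0 addr0.
have LK := prednK (Lam_gt0 U b T mu).
rewrite -{1}LK big_nat_recr//= LK eqxx mulr1.
rewrite big_nat_cond big1 ?add0r => [|i /andP[iL _]]; last first.
  by rewrite (_ : _ == _ = false) ?mulr0//; apply/negbTE; lia.
rewrite Zlaw_last -[in RHS]LK mu_over_DS ?LK//.
by rewrite Dval_Lam.
Qed.

(** Among the paths alive in period t a proportion D_t / D_{t+1} survives the
    next one.  For t = 0 every path is alive, which gives the initial laws. *)
Lemma prob_branch t (V : eqType) (f : outcome -> V) (u v y : V) : (t < L)%N ->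
  (forall w, alive U b T mu t (Zof w) w.2 ->
     f w = if alive U b T mu t.+1 (Zof w) w.2 then u else v) ->
  prob ([set w | f w = y] `&` survivors t) =
  prob (survivors t) * two_point u (D t / D t.+1) v (1 - D t / D t.+1) y.
Proof.
move=> tL fE.
have := prob_survivors t.+1; rewrite (minn_idPl tL) mu_over_DS//.
rewrite (_ : surv t = prob (survivors t)) => [alS|]; last first.
  by rewrite prob_survivors (minn_idPl (ltnW tL)).
(* Survivors take the value u, those who die in period t + 1 the value v. *)
transitivity ((y == u)%:R * prob (survivors t.+1) +
  (y == v)%:R * (prob (survivors t) - prob (survivors t.+1))).
  rewrite /mass !mulr_sumr -sumrB mulr_sumr -big_split.
  apply: eq_bigr => w _ /=.
  rewrite in_setI !mem_setb.
  have -> : (w \in [set w | f w = y]) = (f w == y).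
    by apply/idP/eqP; rewrite in_setE.
  have [al|dead] := boolP (alive U b T mu t _ _).
    by rewrite fE// andbT [_ == y]eq_sym; case: ifP => _ /=; ring.
  by rewrite andbF (negbTE (contra (alive_le (leqnSn t)) dead)) /=; ring.
rewrite alS /two_point; ring.
Qed.

Lemma statew_step t w : (t < L)%N -> alive U b T mu t (Zof w) w.2 ->
  statew t.+1 w = if alive U b T mu t.+1 (Zof w) w.2 then (X t.+1, D t.+1)
                  else (X t.+1, 0).
Proof.
move=> tL al; rewrite state_step//; last by have /andP[] := Zof_bnd w.
by case: ifP.
Qed.

Lemma state_alive_eq t w w0 : alive U b T mu t (Zof w) w.2 ->
  alive U b T mu t (Zof w0) w0.2 -> statew t w = statew t w0.
Proof. by move=> al al0; rewrite !state_alive. Qed.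

Lemma state2_alive t w w0 : (0 < t)%N -> (statew t w).2 = (statew t w0).2 ->
  alive U b T mu t (Zof w) w.2 = alive U b T mu t (Zof w0) w0.2.
Proof.
by move=> t0 e; apply: negb_inj; rewrite -!state2_eq0// e.
Qed.

Context (R : realType) (P : probability (finite_space outcome0) R).
Hypothesis PE : forall A, P A = (ratr (prob A))%:E.

Lemma cprob_branch t (V : eqType) (f : outcome -> V) (u v y : V) : (t < L)%N ->
  (0 < P (survivors t))%E ->
  (forall w, alive U b T mu t (Zof w) w.2 ->
     f w = if alive U b T mu t.+1 (Zof w) w.2 then u else v) ->
  cprob P [set w | f w = y] (survivors t) =
  ratr (two_point u (D t / D t.+1) v (1 - D t / D t.+1) y).
Proof.
move=> tL; rewrite (finite_gt0 PE) (cprobE PE) => al0 fE.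
by rewrite (prob_branch y tL fE) mulrAC divff ?mul1r// lt0r_neq0.
Qed.

Lemma pmf_branch (V : eqType) (f : outcome -> V) (u v y : V) :
  (forall w, f w = if alive U b T mu 1 (Zof w) w.2 then u else v) ->
  P [set w | f w = y] = (ratr (two_point u (mu / D 1) v (1 - mu / D 1) y))%:E.
Proof.
move=> fE.
have := @prob_branch 0 V f u v y (Lam_gt0 U b T mu) (fun w _ => fE w).
rewrite prob_survivors min0n mul1r => <-; rewrite PE; congr (ratr (prob _))%:E.
by apply/seteqP; split=> [w fw|w []//]; split=> //=; exact: alive0.
Qed.

(** Given the present state, a dead path has a certain future.  If the present
    demand is nonzero the path is alive, hence so was its past, and conditioning
    on the past is the same as conditioning on the present. *)
Lemma path_markov : is_markov P (fun t w => statew t w).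
Proof.
case=> // t m; rewrite ltnS subn1 /= => t0 Ppast.
set past := [set w | _] in Ppast *; set now := [set w | statew t w = _].
have past_now : past `<=` now by move=> w; apply; rewrite t0 leqnn.
have Pnow : (0 < P now)%E.
  by apply: lt_le_trans Ppast _; apply: le_measure; rewrite ?inE.
have [w0 w0past] := finite_gt0_nonempty Ppast.
have w0now := past_now _ w0past.
have [al0|dead0] := boolP (alive U b T mu t (Zof w0) w0.2).
  suff -> : past = now by [].
  apply/seteqP; split=> // w wnow s /andP[s0 st].
  rewrite -w0past ?s0//; apply: state_alive_eq; apply: alive_le (st) _ => //.
  by rewrite (@state2_alive t w w0)// wnow w0now.
have stay w : now w -> statew t.+1 w = m t.
  move=> wnow; rewrite state_step_dead//.
  by rewrite (@state2_alive t w w0)// wnow w0now.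
rewrite !(cprob_sure PE (c := m t))//.
by move=> w /past_now; exact: stay.
Qed.

Lemma path_init : has_pmf P (fun w => statew 1 w) (Minit U b T mu).
Proof.
move=> y; apply: pmf_branch => w.
by rewrite statew_step ?Lam_gt0// alive0.
Qed.

(** If m is not a dead state, being in state m is the same as being alive. *)
Lemma path_transition t m m' : (0 < t < L)%N ->
  (0 < P [set w | statew t w = m])%E ->
  cprob P [set w | statew t.+1 w = m'] [set w | statew t w = m] =
  ratr (Mtrans U b T mu t.+1 m m').
Proof.
move=> /andP[t0 tL] Pm; have [w0 w0m] := finite_gt0_nonempty Pm.
rewrite /= in w0m; rewrite /Mtrans -w0m state2_eq0//; rewrite -w0m in Pm.
have [al0|dead0] := boolP (alive U b T mu t (Zof w0) w0.2) => /=.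
  have now : [set w | statew t w = statew t w0] = survivors t.
    apply/seteqP; split=> w /= => [e|al]; last exact: state_alive_eq.
    by rewrite (@state2_alive t w w0)// e.
  rewrite now in Pm *; apply: cprob_branch => // w al.
  exact: statew_step.
rewrite (cprob_sure PE (c := statew t w0))//; last first.
  move=> w e; rewrite state_step_dead//.
  by rewrite (@state2_alive t w w0)// e.
by rewrite [in RHS]state_dead// state_dead.
Qed.

Lemma path_absorbed t w : (L < t)%N ->
  ((statew L w).2 = 0 -> statew t w = ((statew L w).1, 0)) /\
  ((statew L w).2 = U -> statew t w = (U, U)).
Proof.
move=> Lt; have L0 := Lam_gt0 U b T mu.
have := @state2_eq0 U b T mu T_gt0 U_gt0 b_gt0 L (Zof w) w.2 L0.
have [al|dead] := boolP (alive U b T mu L _ _) => /= s2.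
  split=> [e|_]; first by rewrite e eqxx in s2.
  case: t Lt => // t Lt; apply: state_step_cap => //.
  by move: al; rewrite /alive ltnn ltnNge -ltnS Lt.
split=> [_|e]; last by rewrite e gt_eqF in s2.
rewrite !state_dead//; apply: contra dead; apply: alive_le; exact: ltnW.
Qed.

Definition demand (w : outcome) : T.-tuple rat :=
  [tuple (statew i.+1 w).2 | i < T].

Lemma entry_demand t w : (0 < t <= T)%N -> entry (demand w) t = (statew t w).2.
Proof.
case: t => // t tT; rewrite /entry /=.
by rewrite -[t]/(val (Ordinal (tT : t < T)%N)) nth_mktuple.
Qed.

Lemma entry_take (k s : nat) (d : seq rat) : (0 < s <= k)%N ->
  entry (take k d) s = entry d s.
Proof. by case: s => // s sk; rewrite /entry nth_take. Qed.

Lemma take_demand t w w0 : (t <= T)%N ->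
  (forall s, (0 < s <= t)%N -> (statew s w).2 = (statew s w0).2) ->
  take t (demand w) = take t (demand w0).
Proof.
move=> tT e; apply: (@eq_from_nth _ 0); rewrite !size_takel ?size_tuple//.
move=> i it.
rewrite !nth_take//; have := e i.+1 it.
by rewrite -!entry_demand//; exact: leq_trans tT.
Qed.

Lemma xhat_demand x0 t w d : 0 <= x0 <= chiMAR U b T mu -> (0 < t <= T)%N ->
  (forall s, (0 < s < t)%N -> entry d s = entry (demand w) s) ->
  xhat U b T mu x0 t d = (statew t w).1.
Proof.
move=> x0chi tT dE; apply: xhat_state => //; first exact: Zof_bnd.
by move=> s st; rewrite dE// entry_demand//; lia.
Qed.

Lemma demand_bnd w t : (0 < t <= T)%N -> 0 <= entry (demand w) t <= U.
Proof.
move=> /[dup] tT /andP[t0 _]; rewrite entry_demand//.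
by have [] := state_bnd T_gt0 U_gt0 b_gt0 mu_bnd w.2 t0 (Zof_bnd w).
Qed.

Lemma demand_pmf1 x0 : 0 <= x0 <= chiMAR U b T mu ->
  has_pmf P (fun w => entry (demand w) 1)
    (qlaw U b T (xhat U b T mu x0 1 [::]) mu).
Proof.
move=> x0chi y; have L0 := Lam_gt0 U b T mu.
rewrite (xhat_demand (w := outcome0))//; last by case=> [|[]].
rewrite statew_step ?alive0//.
have -> : (if alive U b T mu 1 (Zof outcome0) outcome0.2
  then (X 1, D 1) else (X 1, 0)).1 = X 1 by case: ifP.
(* As D_0 = mu, this is the step of the path from t = 0. *)
rewrite -[X in qlaw U b X]subn0
  -[X in qlaw _ _ _ _ X](erefl : D 0 = mu) qlaw_path//.
apply: pmf_branch => w; rewrite entry_demand// statew_step ?alive0//.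
by case: ifP.
Qed.

(** A history with positive probability whose last demand is 0 has a certain
    continuation.  Otherwise it is the history of all survivors, the policy
    orders the value of the surviving path, and Nature's coin is the survival
    coin. *)
Lemma demand_cond x0 t d a : 0 <= x0 <= chiMAR U b T mu -> (0 < t < T)%N ->
  size d = t -> (0 < P [set w | take t (demand w) = d])%E ->
  cprob P [set w | entry (demand w) t.+1 = a] [set w | take t (demand w) = d] =
  ratr (qlaw U b (T - t) (xhat U b T mu x0 t.+1 d) (entry d t) a).
Proof.
move=> x0chi /andP[t0 tT] dt Pd; have [w0 w0d] := finite_gt0_nonempty Pd.
rewrite /= in w0d.
have dE w s : take t (demand w) = d -> (0 < s <= t)%N ->
    entry d s = (statew s w).2.
  by move=> <- st; rewrite entry_take// entry_demand//; lia.
rewrite (xhat_demand (w := w0))// ?t0//; last first.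
  by move=> s st; rewrite -w0d entry_take//; lia.
have demandS w : entry (demand w) t.+1 = (statew t.+1 w).2.
  by rewrite entry_demand.
rewrite (dE w0 t)// ?t0 ?leqnn//.
have al_eq w : take t (demand w) = d ->
    alive U b T mu t (Zof w) w.2 = alive U b T mu t (Zof w0) w0.2.
  by move=> wd; apply: state2_alive => //; rewrite -!dE ?t0 ?leqnn.
have [al0|dead0] := boolP (alive U b T mu t (Zof w0) w0.2); last first.
  rewrite [in RHS](state_dead dead0) qlaw_zero.
  rewrite (cprob_sure PE (c := 0))// => w wd.
  rewrite demandS; apply/eqP; rewrite state2_eq0//.
  by apply: contra dead0; rewrite -(al_eq w wd); exact: alive_le.
have now : [set w | take t (demand w) = d] = survivors t.
  apply/seteqP; split=> w /= => [/al_eq->//|al].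
  rewrite -w0d; apply: take_demand; first exact: ltnW.
  move=> s /andP[s0 st]; congr (_.2).
  by apply: state_alive_eq; apply: alive_le (st) _.
have [tL|Lt] := ltnP t L.
  rewrite statew_step// (state_alive al0) (ltnW tL) /=.
  have -> : (if alive U b T mu t.+1 (Zof w0) w0.2
    then (X t.+1, D t.+1) else (X t.+1, 0)).1 = X t.+1 by case: ifP.
  rewrite qlaw_path// now in Pd *; apply: cprob_branch => // w al.
  by rewrite demandS statew_step//; case: ifP.
rewrite state_step_cap// state2_cap// al0 mulr1 qlaw_cap//.
apply: (cprob_sure PE) => // w; rewrite now => al.
by rewrite demandS state_step_cap.
Qed.

Lemma path_description w :
  [/\ (forall t, (1 <= t <= Zof w - 1)%N -> statew t w = (X t, D t)),
      ((Zof w <= L - 1)%N -> forall t, (Zof w <= t)%N ->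
        statew t w = (X (Zof w), 0)),
      (Zof w = L -> Yof w.2 = U -> statew L w = (X L, U) /\
         forall t, (L < t)%N -> statew t w = (U, U)),
      (Zof w = L -> Yof w.2 = 0 -> forall t, (L <= t)%N ->
        statew t w = (X L, 0))
    & (forall t, (t < L)%N -> (statew t w).2 = D t * (t < Zof w)%N%:R) /\
      (forall t, (L <= t)%N ->
        (statew t w).2 = U * ((Zof w == L) && (Yof w.2 == U))%:R)].
Proof.
have /andP[z0 zL] := Zof_bnd w.
have Y0 : (Yof w.2 == 0) = ~~ w.2.
  by rewrite /Yof; case: w.2; rewrite ?eqxx ?(gt_eqF U_gt0).
have YU : (Yof w.2 == U) = w.2.
  by rewrite /Yof; case: w.2; rewrite ?eqxx ?(lt_eqF U_gt0).
split.
- move=> t tz; have tL : (t < L)%N by lia.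
  by rewrite state_alive ?(ltnW tL)// /alive tL; lia.
- move=> zL' t zt; apply: state_dead; rewrite /alive; case: ifP; first by lia.
  by rewrite negb_and (_ : _ != _)//; lia.
- move=> eL /eqP; rewrite YU => y.
  have al t : (L <= t)%N -> alive U b T mu t (Zof w) w.2.
    by move=> Lt; rewrite /alive ltnNge Lt eL eqxx.
  split=> [|t Lt]; first by rewrite state_alive ?al// leqnn Dval_Lam.
  by rewrite state_alive ?al ?(ltnW Lt)// leqNgt Lt.
- move=> eL /eqP; rewrite Y0 => y t Lt; rewrite state_dead ?eL//.
  by rewrite /alive ltnNge Lt (negbTE y) andbF.
- split=> t tL.
    rewrite /state /alive tL; case: ifP => _; last by rewrite mulr0.
    by rewrite (ltnW tL) mulr1.
  by rewrite state2_cap// YU /alive ltnNge tL.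
Qed.

End coupling.

Theorem corollary2 (R : realType) (U b : rat) (T : nat) (mu x0 : rat)
    (hU : 0 < U) (hb : 0 < b) (hT : (1 <= T)%N)
    (hmu : 0 <= mu <= U) (hx0U : 0 <= x0 <= U)
    (hx0 : 0 <= x0 <= chiMAR U b T mu) :
  let L := Lam U b T mu in
  let X := Xval U b T mu in
  let D := Dval U b T mu in
  exists (d : measure_display) (Omega : measurableType d)
         (P : probability Omega R)
         (Dhat : {RV P >-> T.-tuple rat})
         (M : nat -> {RV P >-> (rat * rat)%type})
         (Z : {RV P >-> nat}) (Y : {RV P >-> rat}),
    [/\ is_Qhat U b mu x0 (distribution P Dhat),
        is_MT U b T mu M,
        has_pmf P Z (Zlaw U b T mu) /\ has_pmf P Y (Ylaw U b T mu),
        independent_RV Z Y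
      & {ae P, forall w,
          (forall t : nat, (1 <= t <= T)%N ->
             (xhat U b T mu x0 t (take (t - 1) (Dhat w)), entry (Dhat w) t)
             = M t w) /\
          [/\ (forall t : nat, (1 <= t <= Z w - 1)%N -> M t w = (X t, D t)),
              ((Z w <= L - 1)%N ->
                 forall t : nat, (Z w <= t <= T)%N -> M t w = (X (Z w), 0)),
              (Z w = L -> Y w = U ->
                 M L w = (X L, U) /\
                 (forall t : nat, (L + 1 <= t <= T)%N -> M t w = (U, U))),
              (Z w = L -> Y w = 0 ->
                 forall t : nat, (L <= t <= T)%N -> M t w = (X L, 0))
            & (forall t : nat, (1 <= t <= L - 1)%N ->
                 entry (Dhat w) t = D t * (t < Z w)%N%:R) /\
              (forall t : nat, (L <= t <= T)%N ->
                 entry (Dhat w) t = U * ((Z w == L) && (Y w == U))%:R)]}].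
Proof.
move=> L X D.
have [P PE] := @finite_probability _ (outcome0 U b T mu) _
  (weight_ge0 hU hb hT hmu) (weight_sum1 hU hb hT hmu) R.
exists _, _, P, (finite_rv (x0 := outcome0 U b T mu) (@demand U b T mu)).
exists (fun t => finite_rv (x0 := outcome0 U b T mu)
  (fun w => state U b T mu t (Zof w) w.2)).
exists (finite_rv (x0 := outcome0 U b T mu) (@Zof U b T mu)).
exists (finite_rv (x0 := outcome0 U b T mu) (fun w => Yof U w.2)).
have L0 : (0 < L)%N := Lam_gt0 U b T mu.
split.
- split.
  + rewrite -(probability_setT P); apply: (congr1 P).
    by apply/seteqP; split=> // w _ t tT; exact: (demand_bnd hU hb hT hmu).
  + exact: (demand_pmf1 hU hb hT hmu PE hx0).
  + move=> t d a tT dt Pd.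
    have tT' : (0 < t < T)%N by lia.
    exact: (demand_cond hU hb hT hmu PE a hx0 tT' dt Pd).
- split.
  + exact: path_markov.
  + exact: path_init.
  + case=> // t m m'; rewrite ltnS subn1 => tL.
    exact: path_transition.
  + move=> t Lt; apply: aeW => w /=; rewrite addn1 in Lt.
    exact: (path_absorbed hU hb hT w Lt).
- split=> y.
  + by rewrite -(prob_Z hU hb hT hmu y) -PE.
  + by rewrite -(prob_Y hU hb hT hmu y) -PE.
- move=> E G _ _; rewrite !PE -EFinM -rmorphM /= -(prob_ZY hU hb hT hmu E G).
  by [].
- apply: aeW => w.
  have [wa wb wc wd [we wf]] := path_description hU hb hT hmu w.
  have ent t : (0 < t <= T)%N -> entry (demand w) t = _ := entry_demand w.
  split=> [t tT|].
    rewrite /= /finite_rv ent// [RHS]surjective_pairing; congr pair.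
    apply: xhat_demand => // s st.
    by rewrite entry_take//; lia.
  rewrite /= /finite_rv; split.
  + exact: wa.
  + by move=> zL t /andP[zt _]; apply: wb.
  + move=> eL y; have [w1 w2] := wc eL y; split=> // t /andP[Lt _].
    by apply: w2; rewrite -addn1.
  + by move=> eL y t /andP[Lt _]; apply: wd.
  + split=> t /andP[t1 t2].
      by rewrite ent ?we//; have := Lam_leT U b mu hT; lia.
    by rewrite ent ?wf//; lia.
Qed.
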